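(* Let $X,Y$ be real Hilbert spaces, $K:X\to Y$ a nonzero bounded linear operator, $G:X\to\mathbb R$ and $F^*:Y\to\mathbb R$ smooth convex functions with convexity constants $\gamma,\rho\ge0$, and $\alpha\in(0,1/\|K\|]$. Let positive sequences $\{\phi_i\},\{\psi_i\},\{\tau_i\},\{\sigma_i\},\{\lambda_i\}$ satisfy, for all $i\in\mathbb N=\{0,1,\dots\}$, $$\phi_i\tau_i=\psi_i\sigma_i,\quad \phi_i\tau_i=(1-\lambda_{i+1})\phi_{i+1}\tau_{i+1},\quad \lambda_{i+1}^2\phi_{i+1}-\lambda_i^2\phi_i=2\gamma\phi_i\tau_i\lambda_i,$$ $$\lambda_{i+1}^2\psi_{i+1}-\lambda_i^2\psi_i=2\rho\psi_i\sigma_i\lambda_i,\quad \psi_i\lambda_i^2=\phi_i\tau_i^2/\alpha^2,$$ and let $\{u^i=(x^i,y^i)\}$ be generated by the inertial corrected primal-dual proximal splitting (defined in the context) with these parameters and $\mu_{i+1}=\lambda_{i+1}$, with auxiliary sequence $z^i=(\zeta^i,\eta^i)$. Put $\Phi_i=\phi_i\lambda_i^2$, $\Psi_i=\psi_i\lambda_i^2$, $\Theta_i=\phi_i\tau_i$. Then for all $i\in\mathbb N$, $$\frac{\Phi_{i+1}-\Phi_i}{\lambda_i}=2\gamma\Theta_i,\quad \frac{\Psi_{i+1}-\Psi_i}{\lambda_i}=2\rho\Theta_i,\quad \frac{\Theta_{i+1}-\Theta_i}{\lambda_{i+1}}=\Theta_{i+1},\quad \lambda_i=\frac{\alpha\sqrt{\Phi_i\Psi_i}}{\Theta_i},$$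 $$\frac{x^{i+1}-x^i}{\lambda_i}=\zeta^{i+1}-x^i,\qquad \frac{y^{i+1}-y^i}{\lambda_{i+1}}=\eta^{i+1}-y^i,$$ $$\Phi_i\frac{\zeta^{i+1}-\zeta^i}{\lambda_i}=\Theta_i\left[\gamma(x^{i+1}-\zeta^{i+1})-\nabla G(x^{i+1})-K^*\eta^i\right],$$ $$\Psi_{i+1}\frac{\eta^{i+1}-\eta^i}{\lambda_{i+1}}=\Theta_{i+1}\left[\rho(y^{i+1}-\eta^{i+1})-\nabla F^*(y^{i+1})+K\bar\zeta^{i+1}\right],$$ where $\bar\zeta^{i+1}=\zeta^{i+1}+\omega_i(\zeta^{i+1}-\zeta^i)$ and $\omega_i=\lambda_i/\lambda_{i+1}-\lambda_i$.
   Context: $F^*$ denotes the Fenchel conjugate of a proper lower semicontinuous convex function $F:Y\to(-\infty,+\infty]$. $G$ has convexity constant $\gamma\ge0$ if $G-\frac{\gamma}{2}\|\cdot\|^2$ is convex; similarly for $F^*$ and $\rho$. Write $U=X\times Y$. The inertial corrected primal-dual proximal splitting (IC-PDPS): start from $u^0=\bar u^0\in U$; for $i\in\mathbb N$, $u^{i+1}\in U$ and $\bar u^{i+1}\in U$ satisfy $$0=W_{i+1}H(u^{i+1})+M_{i+1}(u^{i+1}-\bar u^i)+W_{i+1}\Gamma(\Lambda_{i+1}^{-1}-I)(u^{i+1}-u^i),$$ $$\bar u^{i+1}=u^{i+1}+\Lambda_{i+2}(\Lambda_{i+1}^{-1}-I)(u^{i+1}-u^i),$$ where, for $u=(x,y)$,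 $$H(u)=\begin{pmatrix}\nabla G(x)+K^*y\\ \nabla F^*(y)-Kx\end{pmatrix},\quad \Gamma=\begin{pmatrix}\gamma I&K^*\\-K&\rho I\end{pmatrix},\quad W_{i+1}=\mathrm{diag}(\tau_iI,\sigma_{i+1}I),$$ $$\Lambda_{i+1}=\mathrm{diag}(\lambda_iI,\mu_{i+1}I),\quad M_{i+1}=\begin{pmatrix}I&-\mu_{i+1}^{-1}\tau_iK^*\\-\lambda_i^{-1}\sigma_{i+1}\omega_iK&I\end{pmatrix},\quad \omega_i=\frac{\lambda_i\phi_i\tau_i}{\lambda_{i+1}\phi_{i+1}\tau_{i+1}}.$$ The auxiliary sequence is $z^0=u^0$, $z^{i+1}=\Lambda_{i+1}^{-1}u^{i+1}-(\Lambda_{i+1}^{-1}-I)u^i$. *)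

(* Defs.v *)
From HB Require Import structures.
From mathcomp Require Import all_boot all_order all_algebra.
From mathcomp Require Import all_classical all_reals all_analysis.
From mathcomp Require Import sesquilinear.

Set Implicit Arguments.
Unset Strict Implicit.
Unset Printing Implicit Defensive.

Import Order.TTheory GRing.Theory Num.Theory.
Import numFieldNormedType.Exports.

Local Open Scope classical_set_scope.
Local Open Scope ring_scope.

HB.mixin Record CompleteNormedModule_isHilbert (R : realType) V
    & CompleteNormedModule R V := {
  inner : {dot V for @idfun R} ;
  sqr_norm_inner : forall x : V, `|x| ^+ 2 = inner x x
}.

#[short(type="hilbertType")]
HB.structure Definition Hilbert (R : realType) :=
  {V of CompleteNormedModule R V & CompleteNormedModule_isHilbert R V}.

Section hilbert_operators.
Context {R : realType}.
Implicit Types X Y : hilbertType R.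

Definition bounded_operator X Y (K : X -> Y) : Prop :=
  exists M : R, forall x, `|K x| <= M * `|x|.

Definition opnorm X Y (K : X -> Y) : R :=
  sup [set `|K x| | x in [set x : X | `|x| <= 1]].

(* When K is linear and bounded, Riesz' theorem provides a unique value
   satisfying the defining property, so that get never returns its default. *)
Definition adjoint X Y (K : X -> Y) (y : Y) : X :=
  get [set x' : X | forall x : X, inner (K x) y = inner x x'].

(* The Riesz representative of the Frechet differential; unique whenever f is
   differentiable at x. *)
Definition gradient X (f : X -> R) (x : X) : X :=
  get [set g : X | forall h : X, 'd f x h = inner g h].

End hilbert_operators.

Section convex_analysis.
Context {R : realType}.
Implicit Types X Y : hilbertType R.

Definition has_convexity_constant X (f : X -> R) (c : R) : Prop :=
  0 <= c /\
  convex_function [set: convex_lmodType X]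
    (fun x : X => f x - c / 2 * `|x| ^+ 2).

Local Open Scope ereal_scope.

Definition proper_function Y (F : Y -> \bar R) : Prop :=
  (forall y, F y != -oo) /\ (exists y, F y != +oo).

Definition econvex_function Y (F : Y -> \bar R) : Prop :=
  forall (y y' : Y) (t : R), (0 < t < 1)%R ->
    F (t *: y + (1 - t) *: y')%R <= t%:E * F y + (1 - t)%:E * F y'.

Definition fenchel_conjugate Y (F : Y -> \bar R) (y' : Y) : \bar R :=
  ereal_sup [set (inner y y')%:E - F y | y in [set: Y]].

End convex_analysis.

Section block_operators.
Context {R : realType}.
Implicit Types X Y : hilbertType R.

(* The operator with block matrix (A B; C D) on X * Y. *)
Definition block_op X Y (A : X -> X) (B : Y -> X) (C : X -> Y) (D : Y -> Y)
    (u : X * Y) : X * Y :=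
  (A u.1 + B u.2, C u.1 + D u.2).

Definition diag_op X Y (a b : R) (u : X * Y) : X * Y :=
  (a *: u.1, b *: u.2).

End block_operators.

(* The operators carry the index i of W_{i+1}, Lambda_{i+1}, M_{i+1}: that is,
   [ic_W i] is W_{i+1}, and so on. Likewise mu and sigma are read at i+1. *)
Section ic_pdps.
Context {R : realType} {X Y : hilbertType R}.
Variables (G : X -> R) (Fs : Y -> R) (K : X -> Y) (gamma rho : R).
Variables (phi tau sigma lambda mu : nat -> R).
Implicit Types (u ubar : nat -> X * Y) (i : nat).

Definition ic_omega i : R :=
  (lambda i * phi i * tau i) / (lambda i.+1 * phi i.+1 * tau i.+1).

Definition ic_H (u : X * Y) : X * Y :=
  (gradient G u.1 + adjoint K u.2, gradient Fs u.2 - K u.1).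

Definition ic_Gamma : X * Y -> X * Y :=
  block_op (fun x => gamma *: x) (fun y => adjoint K y)
           (fun x => - K x)      (fun y => rho *: y).

Definition ic_W i : X * Y -> X * Y := diag_op (tau i) (sigma i.+1).

Definition ic_Lambda i : X * Y -> X * Y := diag_op (lambda i) (mu i.+1).

Definition ic_Lambda_inv i : X * Y -> X * Y :=
  diag_op (lambda i)^-1 (mu i.+1)^-1.

Definition ic_Lambda_inv_sub_id i (u : X * Y) : X * Y :=
  ic_Lambda_inv i u - u.

Definition ic_M i : X * Y -> X * Y :=
  block_op
    (fun x => x)
    (fun y => - ((mu i.+1)^-1 * tau i) *: adjoint K y)
    (fun x => - ((lambda i)^-1 * sigma i.+1 * ic_omega i) *: K x)
    (fun y => y).

Definition ic_pdps u ubar : Prop :=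
  ubar 0%N = u 0%N /\
  forall i,
    0 = ic_W i (ic_H (u i.+1)) + ic_M i (u i.+1 - ubar i)
        + ic_W i (ic_Gamma (ic_Lambda_inv_sub_id i (u i.+1 - u i)))
    /\
    ubar i.+1 =
      u i.+1 + ic_Lambda i.+1 (ic_Lambda_inv_sub_id i (u i.+1 - u i)).

Definition ic_aux u (i : nat) : X * Y :=
  if i is j.+1 then ic_Lambda_inv j (u j.+1) - ic_Lambda_inv_sub_id j (u j)
  else u 0%N.

End ic_pdps.

(* Main.v *)
(** The update of [ubar] makes [x i.+1 - xbar i] equal to
    [lambda i *: (zeta i.+1 - zeta i)] (and likewise for [y], with index
    [i.+1]), so the implicit step of the algorithm is linear in the increments
    of [zeta] and [eta]. The adjoint of [K], defined by choice, is linear by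
    Riesz' theorem; testing each vector identity against an arbitrary [h] with
    [inner h] then reduces it to a scalar field identity. *)

Require Import Defs.
From HB Require Import structures.
From mathcomp Require Import all_boot all_order all_algebra.
From mathcomp Require Import all_classical all_reals all_analysis.
From mathcomp Require Import sesquilinear ring lra.

Set Implicit Arguments.
Unset Strict Implicit.
Unset Printing Implicit Defensive.

Import Order.TTheory GRing.Theory Num.Theory.
Import numFieldNormedType.Exports.

Local Open Scope classical_set_scope.
Local Open Scope ring_scope.

(** The leading coefficient may vanish, which covers [y = 0] in Cauchy-Schwarz and [h = 0] in the
    Riesz representation. *)
Lemma discriminant_le0 (R : rcfType) (a b c : R) :
  (forall t, 0 <= a * t ^+ 2 + b * t + c) -> b ^+ 2 - 4 * a * c <= 0.
Proof.
move=> ge0; have := @deg_le2_poly_ge0 _ (Poly [:: c; b; a]) (size_Poly _).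
rewrite !coef_Poly; apply=> t; rewrite horner_Poly /=.
by apply: le_trans (ge0 t) _; lra.
Qed.

Section inner_product.
Context {R : realType} {X : hilbertType R}.
Implicit Types x y z : X.

Lemma innerC x y : inner x y = inner y x.
Proof. by rewrite hermC expr0 mul1r. Qed.

Lemma innerDl x y z : inner (x + y) z = inner x z + inner y z.
Proof. exact: linearDl. Qed.

Lemma innerDr x y z : inner x (y + z) = inner x y + inner x z.
Proof. by rewrite innerC innerDl !(innerC x). Qed.

Lemma inner0r x : inner x 0 = 0.
Proof. exact: linear0r. Qed.

Lemma innerNl x y : inner (- x) y = - inner x y.
Proof. exact: linearNl. Qed.

Lemma innerNr x y : inner x (- y) = - inner x y.
Proof. by rewrite innerC innerNl innerC. Qed.

Lemma innerZl a x y : inner (a *: x) y = a * inner x y.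
Proof. exact: linearZl_LR. Qed.

Lemma innerZr a x y : inner x (a *: y) = a * inner x y.
Proof. by rewrite innerC innerZl innerC. Qed.

Definition innerE :=
  (innerDl, innerDr, innerNl, innerNr, innerZl, innerZr).

Lemma inner_ge0 x : 0 <= inner x x.
Proof. by rewrite -sqr_norm_inner sqr_ge0. Qed.

Lemma inner_inj x y : (forall z, inner z x = inner z y) -> x = y.
Proof.
move=> xy; apply/eqP; rewrite -subr_eq0 -normr_eq0 -sqrf_eq0.
by rewrite sqr_norm_inner innerDr innerNr xy subrr.
Qed.

Lemma cauchy_schwarz x y : inner x y ^+ 2 <= inner x x * inner y y.
Proof.
have /discriminant_le0 : forall t,
  0 <= inner y y * t ^+ 2 + 2 * inner x y * t + inner x x.
  move=> t; have := inner_ge0 (x + t *: y).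
  by rewrite !innerE (innerC y x); nra.
by nra.
Qed.

Lemma inner_norm_le x y : `|inner x y| <= `|x| * `|y|.
Proof.
rewrite -ler_sqr ?nnegrE ?mulr_ge0// exprMn !sqr_norm_inner real_normK ?num_real//.
exact: cauchy_schwarz.
Qed.

(* The representative minimises [`|x| ^+ 2 - 2 * f x]: the parallelogram law
   makes any minimising sequence Cauchy, and letting the quadratic polynomial
   [t |-> J (s n + t *: h) - J (s n)] stay above minus the defect gives
   [inner (s n) h --> f h]. *)
Lemma riesz_representation (f : X -> R) (M : R) :
  (forall a x y, f (a *: x + y) = a * f x + f y) ->
  (forall x, `|f x| <= M * `|x|) ->
  exists v, forall x, f x = inner x v.
Proof.
move=> f_lin f_bnd.
have fD x y : f (x + y) = f x + f y.
  by rewrite -[x]scale1r f_lin mul1r scale1r.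
have f0 : f 0 = 0 by have := fD 0 0; rewrite addr0; lra.
have fZ a x : f (a *: x) = a * f x by rewrite -[a *: x]addr0 f_lin f0 addr0.
pose J x := inner x x - 2 * f x.
have J_inf : has_inf (range J).
  split; first by exists (J 0), 0.
  (* With r the norm of [x], [J x] is at least r^2 - 2 M r = (M - r)^2 - M^2. *)
  exists (- M ^+ 2) => _ [x _ <-]; rewrite /J -sqr_norm_inner.
  have := f_bnd x; have := ler_norm (f x); have := sqr_ge0 (M - `|x|); nra.
pose m := inf (range J).
have mJ x : m <= J x by apply: ge_inf; [case: J_inf | exists x].
have /choice[s sJ] : forall n, exists x, J x < m + n.+1%:R^-1.
  move=> n; have [|_ [x _ <-] Jx] := inf_adherent (eps := n.+1%:R^-1) _ J_inf.
    by rewrite invr_gt0.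
  by exists x.
(* The squared distance equals 2 J(x) + 2 J(y) - 4 J((x + y) / 2), and the midpoint value is at
   least [m]. *)
have s_close x y a b : J x < m + a -> J y < m + b ->
    `|x - y| ^+ 2 <= 2 * (a + b).
  move=> Jx Jy; have := mJ (2^-1 *: (x + y)); move: Jx Jy.
  rewrite sqr_norm_inner /J !innerE fZ fD (innerC y x); lra.
have s_cvg : cvgn s.
  apply/cauchy_cvgP/cauchy_exP => e e0.
  (* Two defects below e^2 / 4 make the bound of [s_close] smaller than e^2. *)
  have e4 : 0 < e ^+ 2 / 4 by rewrite divr_gt0 ?exprn_gt0.
  have [N _ NP] := near_infty_natSinv_lt (PosNum e4).
  exists (s N), N => // n /= Nn; rewrite -ball_normE /=.
  rewrite -(@ltr_sqr _ `|_|) ?nnegrE ?(ltW e0)//.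
  apply: le_lt_trans (s_close _ _ _ _ (sJ N) (sJ n)) _.
  have := NP N (leqnn N); have := NP n Nn; rewrite /=.
  by move: (N.+1%:R^-1) (n.+1%:R^-1) => a b; lra.
pose v := limn s; exists v => h.
have step n : (f h - inner h v) ^+ 2 <=
    2 * inner h h * (n.+1%:R^-1 + `|s n - v| ^+ 2).
  have d1 : (f h - inner h (s n)) ^+ 2 <= inner h h * n.+1%:R^-1.
    have /discriminant_le0 : forall t, 0 <= inner h h * t ^+ 2 +
        2 * (inner h (s n) - f h) * t + n.+1%:R^-1.
      move=> t; have := mJ (s n + t *: h); have := sJ n.
      rewrite /J !innerE fD fZ (innerC (s n) h).
      by move: (n.+1%:R^-1) => e; lra.
    by move: (n.+1%:R^-1) => e; lra.
  have := cauchy_schwarz h (s n - v); rewrite -(sqr_norm_inner (s n - v)).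
  rewrite innerDr innerNr.
  (* This is (a + b)^2 <= 2 a^2 + 2 b^2, where a is controlled by the defect of [s n] and b by its
     distance to [v]. *)
  have := sqr_ge0 ((f h - inner h (s n)) - (inner h (s n) - inner h v)).
  by move: (n.+1%:R^-1) d1 => e; nra.
have dist0 : (fun n => `|s n - v|) @ \oo --> (0 : R).
  rewrite -(@normr0 _ X) -(subrr v).
  by apply: cvg_norm; apply: cvgB => //; exact: cvg_cst.
have lim0 : (fun n => 2 * inner h h * (n.+1%:R^-1 + `|s n - v| ^+ 2))
    @ \oo --> (0 : R).
  rewrite -[0](mulr0 (2 * inner h h)); apply: cvgMr.
  rewrite -[0](addr0 0); apply: cvgD; first exact: cvg_harmonic.
  by rewrite -[0](mulr0 0); apply: cvgM.
apply/eqP; rewrite -subr_eq0 -sqrf_eq0 eq_le sqr_ge0 andbT -(cvg_lim _ lim0)//.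
apply: limr_ge; first exact: cvgP lim0.
by near=> n; exact: step.
Unshelve. all: by end_near. Qed.

End inner_product.

(** For fixed [y] the left side is a bounded functional of [x], so by Riesz the set from which
    [adjoint] chooses is inhabited. *)
Lemma inner_adjoint (R : realType) (X Y : hilbertType R) (K : {linear X -> Y})
    (K_bounded : bounded_operator K) x y :
  inner (K x) y = inner x (adjoint K y).
Proof.
have [M KM] := K_bounded.
have [v vP] : exists v, forall x, inner (K x) y = inner x v.
  apply: (@riesz_representation _ _ _ (M * `|y|)) => [a x1 x2|x1].
    by rewrite linearP innerDl innerZl.
  apply: le_trans (inner_norm_le _ _) _.
  by rewrite mulrAC ler_wpM2r.
exact: (@getPex X [set x' | forall x, inner (K x) y = inner x x']
                (ex_intro _ v vP)).
Qed.

Theorem mainTheorem4 (R : realType) (X Y : hilbertType R)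
    (K : {linear X -> Y})
    (K_bounded : bounded_operator K) (K_neq0 : exists x, K x != 0)
    (G : X -> R) (F : Y -> \bar R) (Fs : Y -> R) (gamma rho : R)
    (G_convex : convex_function [set: convex_lmodType X] G)
    (G_smooth : forall x, differentiable G x)
    (G_gamma : has_convexity_constant G gamma)
    (F_proper : proper_function F)
    (F_lsc : lower_semicontinuous F)
    (F_convex : econvex_function F)
    (F_conj : forall y, fenchel_conjugate F y = (Fs y)%:E)
    (Fs_convex : convex_function [set: convex_lmodType Y] Fs)
    (Fs_smooth : forall y, differentiable Fs y)
    (Fs_rho : has_convexity_constant Fs rho)
    (alpha : R) (alpha_bounds : 0 < alpha <= (opnorm K)^-1)
    (phi psi tau sigma lambda mu : nat -> R)
    (params_gt0 : forall i, [/\ 0 < phi i, 0 < psi i, 0 < tau i,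
                                0 < sigma i & 0 < lambda i])
    (phi_tau_psi_sigma : forall i, phi i * tau i = psi i * sigma i)
    (phi_tau_rec : forall i,
      phi i * tau i = (1 - lambda i.+1) * phi i.+1 * tau i.+1)
    (phi_rec : forall i,
      lambda i.+1 ^+ 2 * phi i.+1 - lambda i ^+ 2 * phi i
      = 2 * gamma * phi i * tau i * lambda i)
    (psi_rec : forall i,
      lambda i.+1 ^+ 2 * psi i.+1 - lambda i ^+ 2 * psi i
      = 2 * rho * psi i * sigma i * lambda i)
    (psi_lambda : forall i,
      psi i * lambda i ^+ 2 = phi i * tau i ^+ 2 / alpha ^+ 2)
    (mu_lambda : forall i, mu i.+1 = lambda i.+1)
    (u ubar : nat -> X * Y)
    (u_gen : ic_pdps G Fs K gamma rho phi tau sigma lambda mu u ubar) :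
  let x i := (u i).1 in
  let y i := (u i).2 in
  let zeta i := (ic_aux lambda mu u i).1 in
  let eta i := (ic_aux lambda mu u i).2 in
  let omega := ic_omega phi tau lambda in
  let zetabarS i := zeta i.+1 + omega i *: (zeta i.+1 - zeta i) in
  let Phi i := phi i * lambda i ^+ 2 in
  let Psi i := psi i * lambda i ^+ 2 in
  let Theta i := phi i * tau i in
  forall i : nat,
    [/\ (Phi i.+1 - Phi i) / lambda i = 2 * gamma * Theta i,
        (Psi i.+1 - Psi i) / lambda i = 2 * rho * Theta i,
        (Theta i.+1 - Theta i) / lambda i.+1 = Theta i.+1
      & lambda i = alpha * Num.sqrt (Phi i * Psi i) / Theta i]
    /\ omega i = lambda i / lambda i.+1 - lambda i
    /\ [/\ (lambda i)^-1 *: (x i.+1 - x i) = zeta i.+1 - x i,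
           (lambda i.+1)^-1 *: (y i.+1 - y i) = eta i.+1 - y i,
           Phi i *: ((lambda i)^-1 *: (zeta i.+1 - zeta i))
           = Theta i *: (gamma *: (x i.+1 - zeta i.+1)
                         - gradient G (x i.+1) - adjoint K (eta i))
         & Psi i.+1 *: ((lambda i.+1)^-1 *: (eta i.+1 - eta i))
           = Theta i.+1 *: (rho *: (y i.+1 - eta i.+1)
                            - gradient Fs (y i.+1) + K (zetabarS i))].
Proof.
have lambda_neq0 i : lambda i != 0.
  by rewrite gt_eqF//; case: (params_gt0 i).
move=> x y zeta eta omega zetabarS Phi Psi Theta.
have zetaS i : zeta i.+1 = (lambda i)^-1 *: x i.+1 -
    ((lambda i)^-1 *: x i - x i) by [].
have etaS i : eta i.+1 = (lambda i.+1)^-1 *: y i.+1 -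
    ((lambda i.+1)^-1 *: y i - y i) by rewrite -mu_lambda.
have zeta0 : zeta 0 = x 0 by [].
have eta0 : eta 0 = y 0 by [].
(* The affine map z |-> x^i + lambda_i (z - x^i) sends zeta^{i+1} to x^{i+1} and zeta^i to the
   extrapolated point. At index 0 the latter holds because both points are x^0. *)
have xbar i : x i.+1 - (ubar i).1 = lambda i *: (zeta i.+1 - zeta i).
  apply: inner_inj => h; case: i => [|i].
    rewrite (proj1 u_gen) zetaS zeta0 !innerE -/(x 0).
    by field.
  have /(congr1 fst) /= -> := proj2 (proj2 u_gen i).
  rewrite !zetaS !innerE -/(x i.+1) -/(x i).
  by field; rewrite !lambda_neq0.
have ybar i : y i.+1 - (ubar i).2 = lambda i.+1 *: (eta i.+1 - eta i).
  apply: inner_inj => h; case: i => [|i].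
    rewrite (proj1 u_gen) etaS eta0 !innerE -/(y 0).
    by field.
  have /(congr1 snd) /= -> := proj2 (proj2 u_gen i).
  rewrite !etaS !mu_lambda !innerE -/(y i.+1) -/(y i).
  by field; rewrite !lambda_neq0.
move=> i.
have [phi0 psi0 tau0 sigma0 lam0] := params_gt0 i.
have [phi1 psi1 tau1 sigma1 lam1] := params_gt0 i.+1.
have omegaE : omega i = lambda i / lambda i.+1 - lambda i.
  rewrite /omega /ic_omega -(mulrA (lambda i)) phi_tau_rec; field.
  by rewrite !lt0r_neq0.
(* Rebuilding the pair exposes [0] as a pair, so the step splits into its primal and dual rows. *)
have /(congr1 (fun w => (w.1, w.2))) /= [] := proj1 (proj2 u_gen i).
rewrite -/(x i) -/(y i) -/(x i.+1) -/(y i.+1) xbar ybar -/omega mu_lambda => xeq yeq.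
clearbody x y zeta eta omega; clear u_gen xbar ybar.
split; first split.
- rewrite -[RHS](mulfK (lambda_neq0 i)); congr (_ / _).
  by rewrite /Phi /Theta; have := phi_rec i; lra.
- rewrite -[RHS](mulfK (lambda_neq0 i)); congr (_ / _).
  by rewrite /Psi /Theta phi_tau_psi_sigma; have := psi_rec i; lra.
- rewrite -[RHS](mulfK (lambda_neq0 i.+1)); congr (_ / _).
  by rewrite /Theta; have := phi_tau_rec i; lra.
- have a0 : 0 < alpha by case/andP: alpha_bounds.
  (* [psi_lambda] makes the product a perfect square. *)
  have -> : Phi i * Psi i = (phi i * lambda i * tau i / alpha) ^+ 2.
    by rewrite /Phi /Psi psi_lambda; field; rewrite lt0r_neq0.
  rewrite sqrtr_sqr ger0_norm ?divr_ge0 ?mulr_ge0 ?ltW// /Theta.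
  by field; rewrite !lt0r_neq0.
split => //; split.
- by rewrite zetaS; apply: inner_inj => h; rewrite !innerE; ring.
- by rewrite etaS; apply: inner_inj => h; rewrite !innerE; ring.
(* This is [phi i] times the primal row: H and Gamma together contribute K^* eta^{i+1}, which the
   off-diagonal entry of M turns into K^* eta^i. Moving K^* onto [h] lets the linearity of [inner]
   expand these terms. *)
- apply: inner_inj => h; move/(congr1 (inner h)): xeq.
  rewrite inner0r /Phi /Theta !(zetaS, etaS) !innerE -!inner_adjoint// !innerE.
  move=> xeq; apply/subr0_eq; rewrite -[RHS](mulr0 (phi i)) xeq.
  by field; rewrite !lambda_neq0.
(* This is [psi i.+1] times the dual row: H and Gamma give -K zeta^{i+1}, and M adds the [omega i]
   correction that completes [zetabarS i]. *)
- apply: inner_inj => h; move/(congr1 (inner h)): yeq.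
  rewrite inner0r /Psi /Theta /zetabarS.
  rewrite !(linearD K, linearN K, linearZ_LR K) /= !(zetaS, etaS).
  rewrite !(linearD K, linearN K, linearZ_LR K) /= !innerE phi_tau_psi_sigma.
  move=> yeq; apply/subr0_eq; rewrite -[RHS](mulr0 (psi i.+1)) yeq.
  by field; rewrite !lambda_neq0.
Qed.
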